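(* (1) Every element of $\mathcal{E}(\mathcal{P}_{4,3}^{c0+})$ is a positive multiple of $\mathfrak{e}_{u,v,w}^h$ for some $(u:v:w)\in D_e^h$, or of $\mathfrak{e}_t^{P_2}$ for some $t\in\mathbb{P}^1_{\mathbb{R}}=\mathbb{R}\cup\{\infty\}$. (2) Let $f$ be a real cubic form in four variables with $f(x_2,x_3,x_4,x_1)=f(x_1,x_2,x_3,x_4)$. If $f(1,1,1,1)\ge0$ and $f(0,s,t,1)\ge0$ for all $s,t\in\mathbb{R}_+$, then $f(a,b,c,d)\ge0$ for all $a,b,c,d\in\mathbb{R}_+$.
   Context: $\mathbb{R}_+=[0,\infty)$; $\mathbb{P}^2_+$ is the set of points of $\mathbb{P}^2_{\mathbb{R}}$ having nonnegative homogeneous coordinates. $\mathcal{H}_{4,3}^{c0}$ is the space of real cubic forms $f$ in $a_0,a_1,a_2,a_3$ that are cyclic, $f(a_1,a_2,a_3,a_0)=f(a_0,a_1,a_2,a_3)$, and satisfy $f(1,1,1,1)=0$. $\mathcal{P}_{4,3}^{c0+}$ is the cone of $f\in\mathcal{H}_{4,3}^{c0}$ with $f\ge0$ on $\mathbb{R}_+^4$. $\mathcal{E}(\mathcal{P})$ is the set of extremal elements: $0\ne f\in\mathcal{P}$ such that $f=g+h$, $g,h\in\mathcal{P}$, implies $g,h$ are multiples of $f$. With indices mod $4$, let $S_3=\sum_{i=0}^3a_i^3$, $S_{2,1,0}=\sum a_i^2a_{i+1}$, $S_{2,0,1}=\sum a_i^2a_{i+2}$, $S_{1,2,0}=\sum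 a_i^2a_{i+3}$, $S_{1,1,1}=\sum a_ia_{i+1}a_{i+2}$, and $s_0=S_3-S_{1,1,1}$, $s_1=S_{2,1,0}-S_{1,1,1}$, $s_2=S_{2,0,1}-S_{1,1,1}$, $s_3=S_{1,2,0}-S_{1,1,1}$ (a basis of $\mathcal{H}_{4,3}^{c0}$). For $(u:v:w)\in\mathbb{P}^2_+\setminus\{(1:0:1)\}$ (representatives with nonnegative coordinates) put $$g_0^h(u,v,w)=-v\big(uwv^2-(u+w)(u^2+w^2)v+uw(u-w)^2\big),$$ $$g_1^h(u,v,w)=uv^4-w(u+2w)v^3-2uw(u-w)v^2-u(2u^3+u^2w-3w^3)v+w(u^2-w^2)^2,$$ $$g_2^h(u,v,w)=v\big(v^4+(2u^2-3uw+2w^2)v^2-(u+w)(u^2+w^2)v+(u-w)^2(u^2-uw+w^2)\big),$$ $$g_3^h(u,v,w)=g_1^h(w,v,u),\qquad \mathfrak{e}_{u,v,w}^h=\sum_{i=0}^3g_i^h(u,v,w)\,s_i .$$ (These are well defined up to positive factors.) Let $D_e^h=\{(u:v:w)\in\mathbb{P}^2_+:\ \mathfrak{e}_{u,v,w}^h\in\mathcal{E}(\mathcal{P}_{4,3}^{c0+})\}$. For $t\in\mathbb{R}$ let $\mathfrak{e}_t^{P_2}=s_0+t(t-2)s_1-s_2+t(t+2)s_3$, and $\mathfrak{e}_\infty^{P_2}=s_1+s_3$. *)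

(* Defs.v *)
From mathcomp Require Import all_boot all_order all_algebra.
From mathcomp Require Import reals ring.
From mathcomp Require Export mpoly.

Set Implicit Arguments.
Unset Strict Implicit.
Unset Printing Implicit Defensive.

Import Order.TTheory GRing.Theory Num.Theory.
Local Open Scope ring_scope.

(* In a form in [a_0, ..., a_3] the variable [a_i] is ['X_i] with [i : 'I_4];
   the addition of ['I_4] is that of Z/4, so [i + 1], [i + 2%:R], ... are the
   indices mod 4. *)

Definition point4 (R : realType) (a b c d : R) : 'I_4 -> R :=
  tnth [tuple a; b; c; d].

(* The zero form counts as a cubic form. *)
Definition cyclic_cubic (R : realType) (f : {mpoly R[4]}) : Prop :=
  f \is 3.-homog /\ f \mPo [tuple 'X_(i + 1) | i < 4] = f.

Definition Hc0 (R : realType) (f : {mpoly R[4]}) : Prop :=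
  cyclic_cubic f /\ f.@[point4 1 1 1 1] = 0.

Definition Pc0plus (R : realType) (f : {mpoly R[4]}) : Prop :=
  Hc0 f /\ forall a b c d : R,
    0 <= a -> 0 <= b -> 0 <= c -> 0 <= d -> 0 <= f.@[point4 a b c d].

Definition extremal (R : realType) (V : lmodType R) (P : V -> Prop) (f : V) :
    Prop :=
  [/\ P f, f != 0 &
      forall g h : V, P g -> P h -> f = g + h ->
        (exists k : R, g = k *: f) /\ (exists l : R, h = l *: f)].

Section BasicForms.
Variable R : realType.

Definition S3 : {mpoly R[4]} := \sum_(i < 4) 'X_i ^+ 3.
Definition S210 : {mpoly R[4]} := \sum_(i < 4) 'X_i ^+ 2 * 'X_(i + 1).
Definition S201 : {mpoly R[4]} := \sum_(i < 4) 'X_i ^+ 2 * 'X_(i + 2%:R).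
Definition S120 : {mpoly R[4]} := \sum_(i < 4) 'X_i ^+ 2 * 'X_(i + 3%:R).
Definition S111 : {mpoly R[4]} :=
  \sum_(i < 4) 'X_i * 'X_(i + 1) * 'X_(i + 2%:R).

Definition s0 := S3 - S111.
Definition s1 := S210 - S111.
Definition s2 := S201 - S111.
Definition s3 := S120 - S111.

End BasicForms.

Section ExtremalFamilies.
Variable R : realType.
Implicit Types u v w t : R.

Definition g0h u v w : R :=
  - (v * (u * w * v ^+ 2 - (u + w) * (u ^+ 2 + w ^+ 2) * v
          + u * w * (u - w) ^+ 2)).

Definition g1h u v w : R :=
  u * v ^+ 4 - w * (u + 2 * w) * v ^+ 3 - 2 * u * w * (u - w) * v ^+ 2
  - u * (2 * u ^+ 3 + u ^+ 2 * w - 3 * w ^+ 3) * v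
  + w * (u ^+ 2 - w ^+ 2) ^+ 2.

Definition g2h u v w : R :=
  v * (v ^+ 4 + (2 * u ^+ 2 - 3 * u * w + 2 * w ^+ 2) * v ^+ 2
       - (u + w) * (u ^+ 2 + w ^+ 2) * v
       + (u - w) ^+ 2 * (u ^+ 2 - u * w + w ^+ 2)).

Definition g3h u v w : R := g1h w v u.

Definition eh u v w : {mpoly R[4]} :=
  g0h u v w *: s0 R + g1h u v w *: s1 R + g2h u v w *: s2 R + g3h u v w *: s3 R.

(* A point of P^2_+ is given by nonnegative homogeneous coordinates, not all
   zero; [eh] is homogeneous of degree 5 (lemma [ehZ]), so that [Deh] does not
   depend on the choice of these coordinates. *)
Definition P2plus u v w : Prop :=
  [/\ 0 <= u, 0 <= v, 0 <= w & (u, v, w) != (0, 0, 0)].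

Definition is_point_101 u v w : Prop := v = 0 /\ u = w.

Definition Deh u v w : Prop :=
  [/\ P2plus u v w, ~ is_point_101 u v w & extremal (@Pc0plus R) (eh u v w)].

(* P^1_R is [option R], with [None] for the point at infinity. *)
Definition eP2 (t : option R) : {mpoly R[4]} :=
  if t is Some t then
    s0 R + (t * (t - 2)) *: s1 R - s2 R + (t * (t + 2)) *: s3 R
  else s1 R + s3 R.

End ExtremalFamilies.

Lemma ehZ (R : realType) (k u v w : R) :
  eh (k * u) (k * v) (k * w) = k ^+ 5 *: eh u v w.
Proof.
have h0 : g0h (k * u) (k * v) (k * w) = k ^+ 5 * g0h u v w.
  by rewrite /g0h; ring.
have h1 x y z : g1h (k * x) (k * y) (k * z) = k ^+ 5 * g1h x y z.
  by rewrite /g1h; ring.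
have h2 : g2h (k * u) (k * v) (k * w) = k ^+ 5 * g2h u v w.
  by rewrite /g2h; ring.
by rewrite /eh /g3h h0 !h1 h2 -!scalerA -!scalerDr.
Qed.

(* Main.v *)
Require Import Defs.
From mathcomp Require Import all_boot all_order all_algebra.
From mathcomp Require Import boolp classical_sets reals ring lra.

(** Put [X = a + c], [Y = b + d], [x = a - c], [y = b - d]. A cyclic cubic form
is a combination of the five orbit sums, and for fixed [X], [Y] it is the sum
of a constant and a quadratic form in [(x, y)] ([cubic_split]). Nonnegative
[a, b, c, d] means that [(x, y)] lies in the rectangle with half-sides [X] and
[Y]. Along a ray from the centre of that rectangle the form is monotone, so
its minimum is attained at the centre or on the boundary. At the centre the
form is controlled by its values at [(1, 1, 1, 1)] and [(1, 0, 1, 0)]; on the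
boundary one variable vanishes. This is the second assertion ([cubic_ge0]).

For the first assertion, write an element of the cone as
[f = al s0 + be s1 + ga s2 + de s3]; by the second assertion, [f] belongs to
the cone as soon as it is nonnegative on the face [a = 0], which [s2] restricts
to [b d (b + d - c)]. Let [f] be extremal.

If [al + ga = f(1,0,1,0) / 2 = 0], the constant in [cubic_split] disappears and
being in the cone means that a binary quadratic form [q] with coefficients
linear in [f] is positive semidefinite ([B0_cone]). The extremal such [q] are
the squares of linear forms, and these are the forms [eP2 t]
([extremal_B0]).

If [al + ga > 0] but [2 al + be + de = f(2,1,0,1) / 4 = 0], then [f] is a
multiple of [(a + b + c + d) (a - b + c - d)^2], which is [8^-1 eh 1 2 1]
([A0_ray]).

In the remaining case [f + e s2] and [f - e s2] cannot both be in the cone for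
any [e > 0]: by extremality they would be multiples of [f], and so would [s2],
on which [2 al + be + de] vanishes. By compactness of the triangle
[{b + c + d = 1}] there is then a point near which [b d] is not bounded by a
multiple of [f]. It is a zero of [f], but not one on the edge [d = 0] from which
[f] grows linearly in [d], nor one on the edge [b = 0] from which [f] grows
linearly in [b]. So all partial derivatives of [f] on the face vanish at the
point found, say [(0, u, v, w)], and [v > 0] ([singular_zero_exists]). The three
equations obtained this way for the four coefficients of [f] have maximal minors
[3 (v - u - w) g_i(u, v, w)]. Here [v - u - w] is not [0], as on the line
[v = u + w] the form is a positive multiple of [2 al + be + de], so Cramer's rule
identifies [f] with a multiple of [eh u v w] ([singular_eh]). The multiple is
positive because [g_0 + g_2 = v (v^2 + (u - w)^2)^2]. *)

Set Implicit Arguments.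
Unset Strict Implicit.
Unset Printing Implicit Defensive.

Import Order.TTheory GRing.Theory Num.Theory.
Local Open Scope ring_scope.

(** * Cyclic cubic forms are combinations of five orbit sums *)

Section CyclicForms.
Variable R : realType.
Implicit Types (p q f : {mpoly R[4]}) (i j k : 'I_4) (al be ga de ep : R).

Definition cycle_vars p : {mpoly R[4]} := p \mPo [tuple 'X_(i + 1) | i < 4].

Lemma cycle_varsX i : cycle_vars 'X_i = 'X_(i + 1).
Proof. by rewrite /cycle_vars comp_mpolyXU -tnth_nth tnth_mktuple. Qed.

Lemma cycle_varsM p q : cycle_vars (p * q) = cycle_vars p * cycle_vars q.
Proof. exact: rmorphM. Qed.

Lemma cycle_varsD p q : cycle_vars (p + q) = cycle_vars p + cycle_vars q.
Proof. exact: comp_mpolyD. Qed.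

Lemma cycle_varsZ a p : cycle_vars (a *: p) = a *: cycle_vars p.
Proof. exact: comp_mpolyZ. Qed.

(** A form fixed by [cycle_vars] is a quarter of its orbit sum, so it is enough
to know the orbit sums of monomials. *)
Definition orbit_sum p :=
  p + cycle_vars p + cycle_vars (cycle_vars p)
  + cycle_vars (cycle_vars (cycle_vars p)).

Lemma orbit_sum_is_linear : linear orbit_sum.
Proof.
move=> a p q; rewrite /orbit_sum !(cycle_varsD, cycle_varsZ) !scalerDr.
by rewrite (AC (2*2*2*2) (1*3*5*7*(2*4*6*8)))%AC.
Qed.

Lemma orbit_sum0 : orbit_sum 0 = 0.
Proof. by rewrite /orbit_sum /cycle_vars !comp_mpoly0 !addr0. Qed.

Lemma forall_I4 (P : 'I_4 -> Prop) :
  P 0 -> P 1 -> P 2%:R -> P 3%:R -> forall i, P i.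
Proof.
move=> P0 P1 P2 P3 [[|[|[|[|//]]]] lt_i].
- by rewrite (_ : Ordinal lt_i = 0); last exact: val_inj.
- by rewrite (_ : Ordinal lt_i = 1); last exact: val_inj.
- by rewrite (_ : Ordinal lt_i = 2%:R); last exact: val_inj.
- by rewrite (_ : Ordinal lt_i = 3%:R); last exact: val_inj.
Qed.

Lemma sum_I4 (V : nmodType) (F : 'I_4 -> V) :
  \sum_i F i = F 0 + F 1 + F 2%:R + F 3%:R.
Proof.
rewrite !big_ord_recl big_ord0 addr0 !addrA.
by congr (F _ + F _ + F _ + F _); apply: val_inj.
Qed.

Lemma addI4 :
  ((0 : 'I_4) + 1 = 1) * ((0 : 'I_4) + 2%:R = 2%:R)
  * ((0 : 'I_4) + 3%:R = 3%:R)
  * ((1 : 'I_4) + 1 = 2%:R) * ((1 : 'I_4) + 2%:R = 3%:R)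
  * ((1 : 'I_4) + 3%:R = 0)
  * ((2%:R : 'I_4) + 1 = 3%:R) * ((2%:R : 'I_4) + 2%:R = 0)
  * ((2%:R : 'I_4) + 3%:R = 1)
  * ((3%:R : 'I_4) + 1 = 0) * ((3%:R : 'I_4) + 2%:R = 1)
  * ((3%:R : 'I_4) + 3%:R = 2%:R).
Proof. by do !split; apply: val_inj. Qed.

Lemma orbit_sum_monomial i j k :
  orbit_sum ('X_i * 'X_j * 'X_k) \in [:: S3 R; S210 R; S201 R; S120 R; S111 R].
Proof.
rewrite !inE /orbit_sum !cycle_varsM !cycle_varsX.
rewrite /S3 /S210 /S201 /S120 /S111 !sum_I4.
move: i j k; do 3! apply: forall_I4; rewrite !addI4; do ![
  by apply/orP; left; apply/eqP; ring | by apply/eqP; ring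
  | apply/orP; right].
Qed.

Lemma mdegS_factor n (m : 'X_{1..4}) : mdeg m = n.+1 ->
  exists i (m' : 'X_{1..4}), 'X_[R, m] = 'X_i * 'X_[m'] /\ mdeg m' = n.
Proof.
move=> deg_m; have [i mi_neq0] : exists i, m i != 0%N.
  apply/existsP; apply: contra_eqT deg_m => /existsPn m0.
  rewrite mdegE big1 // => i _; apply/eqP; exact: negbNE (m0 i).
have mE : m = (U_(i) + (m - U_(i)))%MM by rewrite addmC submK // lep1mP.
exists i, (m - U_(i))%MM; split; first by rewrite -mpolyXD -mE.
by apply: succn_inj; rewrite -deg_m [in RHS]mE mdegD mdeg1.
Qed.

Definition cyclic_form al be ga de ep : {mpoly R[4]} :=
  al *: S3 R + be *: S210 R + ga *: S201 R + de *: S120 R + ep *: S111 R.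

Lemma orbit_sum_homog f : f \is 3.-homog ->
  exists al be ga de ep, orbit_sum f = cyclic_form al be ga de ep.
Proof.
move=> /dhomogP f3; rewrite [f]mpolyE big_seq.
pose P g := exists al be ga de ep, orbit_sum g = cyclic_form al be ga de ep.
apply: (big_ind P) => [|g h|m /f3 deg_m].
- by exists 0, 0, 0, 0, 0; rewrite orbit_sum0 /cyclic_form !scale0r !addr0.
- move=> [al [be [ga [de [ep gE]]]]] [al' [be' [ga' [de' [ep' hE]]]]].
  exists (al + al'), (be + be'), (ga + ga'), (de + de'), (ep + ep').
  rewrite -[g]scale1r orbit_sum_is_linear scale1r gE hE /cyclic_form !scalerDl.
  by rewrite (AC (5*5) (1*6*(2*7)*(3*8)*(4*9)*(5*10)))%AC.
have [i [m1 [-> /mdegS_factor [j [m2 [-> /mdegS_factor [k [m3 [-> /eqP]]]]]]]]]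
  := mdegS_factor deg_m.
rewrite mdeg_eq0 => /eqP ->; rewrite mpolyX0 mulr1 mulrA /P.
rewrite -[_ *: _]addr0 orbit_sum_is_linear orbit_sum0 addr0 /cyclic_form.
set c := f@_m; have := orbit_sum_monomial i j k; rewrite !inE.
case/or4P => [/eqP->|/eqP->|/eqP->|/orP[]/eqP->].
- by exists c, 0, 0, 0, 0; rewrite !scale0r !(addr0, add0r).
- by exists 0, c, 0, 0, 0; rewrite !scale0r !(addr0, add0r).
- by exists 0, 0, c, 0, 0; rewrite !scale0r !(addr0, add0r).
- by exists 0, 0, 0, c, 0; rewrite !scale0r !(addr0, add0r).
- by exists 0, 0, 0, 0, c; rewrite !scale0r !(addr0, add0r).
Qed.

Lemma cyclic_cubicE f : cyclic_cubic f ->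
  exists al be ga de ep, f = cyclic_form al be ga de ep.
Proof.
move=> [f3 rot_f]; have [al [be [ga [de [ep]]]]] := orbit_sum_homog f3.
rewrite /orbit_sum /cycle_vars !rot_f => f4E.
exists (4^-1 * al), (4^-1 * be), (4^-1 * ga), (4^-1 * de), (4^-1 * ep).
rewrite /cyclic_form -!scalerA -!scalerDr -/(cyclic_form al be ga de ep) -f4E.
rewrite -!mulr2n -mulrSr -mulrSr -scaler_nat scalerA mulVf ?scale1r //.
by rewrite pnatr_eq0.
Qed.

End CyclicForms.

(** * Nonnegativity on the orthant is decided on a face *)

Section CubicValues.
Variable R : realFieldType.
Implicit Types (a b c d al be ga de ep : R).

Definition cubic al be ga de ep a b c d : R :=
  al * (a ^+ 3 + b ^+ 3 + c ^+ 3 + d ^+ 3)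
  + be * (a ^+ 2 * b + b ^+ 2 * c + c ^+ 2 * d + d ^+ 2 * a)
  + ga * (a ^+ 2 * c + b ^+ 2 * d + c ^+ 2 * a + d ^+ 2 * b)
  + de * (a ^+ 2 * d + b ^+ 2 * a + c ^+ 2 * b + d ^+ 2 * c)
  + ep * (a * b * c + b * c * d + c * d * a + d * a * b).

Lemma cubic_rot al be ga de ep a b c d :
  cubic al be ga de ep a b c d = cubic al be ga de ep d a b c.
Proof. by rewrite /cubic; ring. Qed.

Definition centre_part al be ga de ep (X Y : R) : R :=
  (X + Y) * ((al + ga) * (X - Y) ^+ 2 + (al + be + ga + de + ep) * (X * Y)).

Lemma centre_part_ge0 al be ga de ep X Y :
  0 <= al + be + ga + de + ep -> 0 <= al + ga -> 0 <= X -> 0 <= Y ->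
  0 <= centre_part al be ga de ep X Y.
Proof.
move=> one_ge0 B_ge0 X0 Y0; apply: mulr_ge0; first exact: addr_ge0.
apply: addr_ge0; apply: mulr_ge0 => //; [exact: sqr_ge0 | exact: mulr_ge0].
Qed.

Definition square_part al be ga de ep (X Y x y : R) : R :=
  x ^+ 2 * ((3 * al - ga) * X + (be + de - ep) * Y)
  + y ^+ 2 * ((3 * al - ga) * Y + (be + de - ep) * X)
  + 2 * (be - de) * (x * y) * (X - Y).

(** Two rotations fix [X] and [Y] and negate [(x, y)], so there are no terms of
odd degree in [(x, y)]. *)
Lemma cubic_split al be ga de ep a b c d :
  4 * cubic al be ga de ep a b c d =
  centre_part al be ga de ep (a + c) (b + d)
  + square_part al be ga de ep (a + c) (b + d) (a - c) (b - d).
Proof. by rewrite /cubic /centre_part /square_part; ring. Qed.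

(** The hypothesis on [`|b - d|] says that the ray from the centre of the
rectangle through [(a - c, b - d)] leaves it through the side where [a = 0].
The exit point, scaled by [c - a], is the point of the face used below. *)
Lemma cubic_side al be ga de ep a b c d :
  0 <= al + be + ga + de + ep -> 0 <= al + ga ->
  (forall b c d, 0 <= b -> 0 <= c -> 0 <= d -> 0 <= cubic al be ga de ep 0 b c d) ->
  0 <= a -> 0 <= b -> 0 <= c -> 0 <= d -> a < c ->
  `|b - d| * (a + c) <= (c - a) * (b + d) ->
  0 <= cubic al be ga de ep a b c d.
Proof.
move=> one_ge0 B_ge0 bd_ge0 a0 b0 c0 d0 ac.
rewrite -{1}(ger0_norm (addr_ge0 a0 c0)) -normrM ler_norml => /andP[h1 h2].
set X := a + c in h1 h2; set Y := b + d in h1 h2; set y := b - d in h1 h2.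
set r := c - a in h1 h2.
have r0 : 0 < r by rewrite /r; lra.
have X0 : 0 < X by rewrite /X; lra.
have Y0 : 0 <= Y by rewrite /Y; lra.
pose b' := (r * Y + y * X) / 2; pose d' := (r * Y - y * X) / 2.
have : 0 <= 4 * cubic al be ga de ep 0 b' (X * r) d'.
  apply: mulr_ge0 => //; apply: bd_ge0.
  - by apply: divr_ge0 => //; rewrite -(opprK (r * Y)) addrC subr_ge0.
  - by rewrite mulr_ge0 ?ltW.
  - by apply: divr_ge0 => //; rewrite subr_ge0.
have -> : 4 * cubic al be ga de ep 0 b' (X * r) d' =
    r * (r ^+ 2 * centre_part al be ga de ep X Y
         + X ^+ 2 * square_part al be ga de ep X Y (a - c) y).
  by rewrite cubic_split /centre_part /square_part /b' /d' /r; field.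
rewrite pmulr_rge0 // => ge0.
rewrite -(@pmulr_rge0 _ 4) // cubic_split -/X -/Y -/y.
rewrite -(@pmulr_rge0 _ (X ^+ 2)) ?exprn_gt0 // mulrDr.
apply: le_trans ge0 _; rewrite lerD2r.
have r_le_X : r <= X by rewrite /r /X; lra.
apply: ler_wpM2r; last by rewrite ler_sqr ?nnegrE ?(ltW r0) ?(ltW X0).
exact: centre_part_ge0 (ltW X0) Y0.
Qed.

Lemma cubic_ge0 al be ga de ep :
  0 <= al + be + ga + de + ep ->
  (forall b c d, 0 <= b -> 0 <= c -> 0 <= d -> 0 <= cubic al be ga de ep 0 b c d) ->
  forall a b c d,
  0 <= a -> 0 <= b -> 0 <= c -> 0 <= d -> 0 <= cubic al be ga de ep a b c d.
Proof.
move=> one_ge0 bd_ge0.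
have B_ge0 : 0 <= al + ga.
  have := bd_ge0 1 0 1 ler01 (lexx 0) ler01.
  have -> : cubic al be ga de ep 0 1 0 1 = 2 * (al + ga) by rewrite /cubic; ring.
  by rewrite pmulr_rge0.
have half a b c d : 0 <= a -> 0 <= b -> 0 <= c -> 0 <= d ->
    `|b - d| * (a + c) <= `|a - c| * (b + d) -> 0 <= cubic al be ga de ep a b c d.
  move=> a0 b0 c0 d0; have [ac|ca|ac] := ltgtP a c => h.
  - apply: cubic_side => //.
    by rewrite -(gtr0_norm (_ : 0 < c - a)) ?subr_gt0 // (distrC c).
  - rewrite 2!cubic_rot; apply: cubic_side => //.
    rewrite [c + a]addrC [`|d - b|]distrC [d + b]addrC.
    by rewrite -(gtr0_norm (_ : 0 < a - c)) ?subr_gt0.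
  - move: h; rewrite ac subrr normr0 mul0r => h.
    have : `|b - d| * (c + c) == 0.
      by rewrite eq_le h mulr_ge0 ?addr_ge0.
    rewrite mulf_eq0 normr_eq0 subr_eq0 => /orP[/eqP bd|cc].
      rewrite -(@pmulr_rge0 _ 4) // cubic_split /square_part bd !subrr.
      by rewrite expr0n !mul0r mulr0 mul0r !addr0 centre_part_ge0 // addr_ge0.
    have -> : c = 0 by move: cc => /eqP; lra.
    exact: bd_ge0.
move=> a b c d a0 b0 c0 d0.
have [h|/ltW h] := leP (`|b - d| * (a + c)) (`|a - c| * (b + d)).
  exact: half.
by rewrite 3!cubic_rot; apply: half; rewrite // [`|c - a|]distrC [c + a]addrC.
Qed.

(** * The face [a = 0] and the forms vanishing at (1, 1, 1, 1) *)

Definition cubic0 al be ga de a b c d :=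
  cubic al be ga de (- (al + be + ga + de)) a b c d.

Definition side_ge0 al be ga de := forall b c d,
  0 <= b -> 0 <= c -> 0 <= d -> 0 <= cubic0 al be ga de 0 b c d.

Lemma cubic0_ge0 al be ga de : side_ge0 al be ga de -> forall a b c d,
  0 <= a -> 0 <= b -> 0 <= c -> 0 <= d -> 0 <= cubic0 al be ga de a b c d.
Proof. by move=> f_ge0; apply: cubic_ge0 => //; rewrite addrN. Qed.

Lemma cubic0_flip al be ga de b c d :
  cubic0 al be ga de 0 b c d = cubic0 al de ga be 0 d c b.
Proof. by rewrite /cubic0 /cubic; ring. Qed.

Lemma cubic0_homog al be ga de k b c d :
  cubic0 al be ga de 0 (k * b) (k * c) (k * d) =
  k ^+ 3 * cubic0 al be ga de 0 b c d.
Proof. by rewrite /cubic0 /cubic; ring. Qed.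

Lemma slope_ge0 (r c1 c2 c3 : R) : 0 < r ->
  (forall t, 0 <= t <= r -> 0 <= t * (c1 + t * (c2 + t * c3))) -> 0 <= c1.
Proof.
move=> r0 ge0; rewrite leNgt; apply/negP => c1_lt0.
pose M := `|c2| + `|c3| + 1.
have M1 : 1 <= M by rewrite lerDr addr_ge0.
have M0 : 0 < M by apply: lt_le_trans M1.
pose t := Num.min (Num.min r 1) (- c1 / (2 * M)).
have t0 : 0 < t.
  by rewrite !lt_min r0 ltr01 divr_gt0 ?oppr_gt0 ?mulr_gt0.
have tr : t <= r by rewrite !ge_min lexx.
have t1 : t <= 1 by rewrite !ge_min lexx orbT.
have tM : t * M <= - c1 / 2.
  have -> : - c1 / 2 = - c1 / (2 * M) * M by field; rewrite gt_eqF.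
  by apply: ler_wpM2r; [exact: ltW | rewrite !ge_min lexx !orbT].
have := ge0 t; rewrite tr (ltW t0) pmulr_rge0 // => /(_ isT) h.
have : c2 + t * c3 <= M.
  rewrite /M; have := ler_norm c2; have := ler_norm (t * c3).
  rewrite normrM (gtr0_norm t0); have := ler_piMl (normr_ge0 c3) t1; lra.
by rewrite -(ler_pM2l t0); lra.
Qed.

Lemma slope_eq0 (r c1 c2 c3 : R) : 0 < r ->
  (forall t, - r <= t <= r -> 0 <= t * (c1 + t * (c2 + t * c3))) -> c1 = 0.
Proof.
move=> r0 ge0; apply/eqP; rewrite eq_le; apply/andP; split.
  rewrite -oppr_ge0; apply: (@slope_ge0 r _ c2 (- c3)) => // t /andP[t0 tr].
  have -> : t * (- c1 + t * (c2 + t * - c3)) =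
      - t * (c1 + - t * (c2 + - t * c3)) by ring.
  by apply: ge0; lra.
apply: (@slope_ge0 r _ c2 c3) => // t /andP[t0 tr]; apply: ge0; lra.
Qed.

Lemma slope_ge0_infty (T0 u v : R) :
  (forall T, T0 <= T -> 0 <= T * u + v) -> 0 <= u.
Proof.
move=> h; rewrite leNgt; apply/negP => u_lt0.
have := h (Num.max T0 ((1 + `|v|) / - u)).
rewrite le_max lexx => /(_ isT).
have : (1 + `|v|) / - u <= Num.max T0 ((1 + `|v|) / - u).
  by rewrite le_max lexx orbT.
set T := Num.max _ _; rewrite ler_pdivrMr ?oppr_gt0 // mulrN.
have := ler_norm v; lra.
Qed.

(** * The degenerate cases *)

(** When [ga = - al], the form only depends on a binary quadratic form [q]: it is
[(a + c) q(x, y) + (b + d) q(y, - x)]. *)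
Lemma cubic0_B0 al be de a b c d :
  let eta := (be + de) / 2 in let ka := (be - de) / 4 in
  let x := a - c in let y := b - d in
  cubic0 al be (- al) de a b c d =
    (a + c) * (al * x ^+ 2 + 2 * ka * (x * y) + eta * y ^+ 2)
    + (b + d) * (eta * x ^+ 2 - 2 * ka * (x * y) + al * y ^+ 2).
Proof. by rewrite /cubic0 /cubic; field. Qed.

(** Letting [a + c] tend to infinity with [a - c], [b - d] and [b + d] fixed shows
that [q] is positive semidefinite; [al], [ka], [eta] are its coefficients. *)
Lemma B0_cone al be de : side_ge0 al be (- al) de ->
  let eta := (be + de) / 2 in let ka := (be - de) / 4 in
  [/\ 0 <= al, 0 <= eta & ka ^+ 2 <= al * eta].
Proof.
move=> /cubic0_ge0 f_ge0 eta ka.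
have q_ge0 x y : 0 <= al * x ^+ 2 + 2 * ka * (x * y) + eta * y ^+ 2.
  pose q' := eta * x ^+ 2 - 2 * ka * (x * y) + al * y ^+ 2.
  apply: (@slope_ge0_infty `|x| _ (`|y| * q')) => T xT.
  have [x1 x2] := (ler_norm x, ler_norm (- x)); rewrite normrN in x2.
  have [y1 y2] := (ler_norm y, ler_norm (- y)); rewrite normrN in y2.
  have := f_ge0 ((T + x) / 2) ((`|y| + y) / 2) ((T - x) / 2) ((`|y| - y) / 2).
  rewrite cubic0_B0 -/eta -/ka.
  have -> : (T + x) / 2 + (T - x) / 2 = T by field.
  have -> : (T + x) / 2 - (T - x) / 2 = x by field.
  have -> : (`|y| + y) / 2 + (`|y| - y) / 2 = `|y| by field.
  have -> : (`|y| + y) / 2 - (`|y| - y) / 2 = y by field.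
  by apply; lra.
have al0 : 0 <= al by have := q_ge0 1 0; lra.
have eta0 : 0 <= eta by have := q_ge0 0 1; lra.
split=> //; have [al_gt0|al_le0] := ltP 0 al.
  rewrite -subr_ge0 -(pmulr_rge0 _ al_gt0).
  by have := q_ge0 ka (- al); congr (0 <= _); ring.
have al_eq0 : al = 0 by lra.
rewrite al_eq0 mul0r -oppr_ge0; have := q_ge0 (- (eta + 1) / 2) ka; rewrite al_eq0.
by congr (0 <= _); field.
Qed.

Lemma eP2_side_ge0 t : side_ge0 1 (t * (t - 2)) (-1) (t * (t + 2)).
Proof.
move=> b c d b0 c0 d0; rewrite cubic0_B0 add0r sub0r.
have -> : (t * (t - 2) + t * (t + 2)) / 2 = t ^+ 2 by field.
have -> : (t * (t - 2) - t * (t + 2)) / 4 = - t by field.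
have -> : c * (1 * (- c) ^+ 2 + 2 * - t * (- c * (b - d)) + t ^+ 2 * (b - d) ^+ 2)
  + (b + d) * (t ^+ 2 * (- c) ^+ 2 - 2 * - t * (- c * (b - d)) + 1 * (b - d) ^+ 2)
  = c * (c + t * (b - d)) ^+ 2 + (b + d) * (t * c - (b - d)) ^+ 2 by ring.
by apply: addr_ge0; apply: mulr_ge0; rewrite ?sqr_ge0 ?addr_ge0.
Qed.

Lemma eP2_None_side_ge0 : side_ge0 0 1 0 1.
Proof.
move=> b c d b0 c0 d0.
have -> : cubic0 0 1 0 1 0 b c d = c * (b - d) ^+ 2 + (b + d) * c ^+ 2.
  by rewrite /cubic0 /cubic; ring.
by apply: addr_ge0; apply: mulr_ge0; rewrite ?sqr_ge0 ?addr_ge0.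
Qed.

(** When [2 al + be + de = 0], the form vanishes on the whole plane
[a + c = b + d]. On the face [a = 0] this line [c = b + d] can be crossed in
both directions, so the derivative across it vanishes at each of its points;
the points [(1, 2, 1)] and [(2, 2, 0)] give enough equations. *)
Lemma A0_ray al be ga de : side_ge0 al be ga de -> 2 * al + be + de = 0 ->
  [/\ be = - al, ga = 3 * al & de = - al].
Proof.
move=> f_ge0 A0.
have de_eq : de = - 2 * al - be by lra.
have ga_eq : ga = 3 * al.
  suff : 4 * (3 * al - ga) = 0 by lra.
  apply: (@slope_eq0 1 _ (16 * al) (4 * al)) => // t /andP[t1 t2].
  have : 0 <= 4 * cubic0 al be ga de 0 1 (2 + t) 1.
    by rewrite mulr_ge0 ?f_ge0 //; lra.
  by rewrite de_eq /cubic0 /cubic; congr (0 <= _); ring.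
suff : - 8 * (be - de) = 0 by split=> //; lra.
apply: (@slope_eq0 1 _ (16 * al - 4 * (be - de)) (4 * al)) => // t /andP[t1 t2].
have : 0 <= 4 * cubic0 al be ga de 0 2 (2 + t) 0.
  by rewrite mulr_ge0 ?f_ge0 //; lra.
by rewrite de_eq ga_eq /cubic0 /cubic; congr (0 <= _); ring.
Qed.

(** * A singular zero on the face determines the form *)

Definition det3 (x1 x2 x3 y1 y2 y3 z1 z2 z3 : R) :=
  x1 * (y2 * z3 - y3 * z2) - x2 * (y1 * z3 - y3 * z1) + x3 * (y1 * z2 - y2 * z1).

(** Cramer's rule: a vector in the kernel of a 3 x 4 matrix is proportional to
the vector of its signed maximal minors. Each identity is obtained by
eliminating the two other unknowns from the three equations. *)
Lemma kernel_minors x0 x1 x2 x3 y0 y1 y2 y3 z0 z1 z2 z3 p0 p1 p2 p3 :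
  x0 * p0 + x1 * p1 + x2 * p2 + x3 * p3 = 0 ->
  y0 * p0 + y1 * p1 + y2 * p2 + y3 * p3 = 0 ->
  z0 * p0 + z1 * p1 + z2 * p2 + z3 * p3 = 0 ->
  let m0 := det3 x1 x2 x3 y1 y2 y3 z1 z2 z3 in
  let m1 := - det3 x0 x2 x3 y0 y2 y3 z0 z2 z3 in
  let m2 := det3 x0 x1 x3 y0 y1 y3 z0 z1 z3 in
  let m3 := - det3 x0 x1 x2 y0 y1 y2 z0 z1 z2 in
  [/\ p0 * m2 = p2 * m0, p1 * m0 = p0 * m1, p1 * m2 = p2 * m1,
      p3 * m0 = p0 * m3 & p3 * m2 = p2 * m3].
Proof.
move=> hx hy hz; set hX := x0 * p0 + _ + _ + _ in hx.
set hY := y0 * p0 + _ + _ + _ in hy; set hZ := z0 * p0 + _ + _ + _ in hz.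
have comb k1 k2 k3 (u v : R) : u - v = k1 * hX + k2 * hY + k3 * hZ -> u = v.
  by rewrite hx hy hz !mulr0 !addr0 => /eqP; rewrite subr_eq0 => /eqP.
rewrite /det3; split.
- by apply: (comb (y1 * z3 - y3 * z1) (z1 * x3 - z3 * x1) (x1 * y3 - x3 * y1));
    rewrite /hX /hY /hZ; ring.
- by apply: (comb (y2 * z3 - y3 * z2) (z2 * x3 - z3 * x2) (x2 * y3 - x3 * y2));
    rewrite /hX /hY /hZ; ring.
- by apply: (comb (y3 * z0 - y0 * z3) (z3 * x0 - z0 * x3) (x3 * y0 - x0 * y3));
    rewrite /hX /hY /hZ; ring.
- by apply: (comb (y1 * z2 - y2 * z1) (z1 * x2 - z2 * x1) (x1 * y2 - x2 * y1));
    rewrite /hX /hY /hZ; ring.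
- by apply: (comb (y0 * z1 - y1 * z0) (z0 * x1 - z1 * x0) (x0 * y1 - x1 * y0));
    rewrite /hX /hY /hZ; ring.
Qed.

(** The derivative of [cubic0 al be ga de 0 b c d] with respect to [d]. By
[cubic0_flip] the one with respect to [b] is [dcubic0 al de ga be d c b]. *)
Definition dcubic0 al be ga de b c d :=
  al * (3 * d ^+ 2 - b * c) + be * (c ^+ 2 - b * c)
  + ga * (b ^+ 2 + 2 * b * d - b * c) + de * (2 * c * d - b * c).

End CubicValues.

Section SingularZero.
Variable R : realType.
Implicit Types (b c d al be ga de : R).

(** The maximal minors of the system of the three partial derivatives have the
common factor [3 (c - b - d)]; the cofactors are the coefficients of
[eh b c d]. The scalar is normalized by the coordinate [al + ga], as
[g0h + g2h] has no zero with [c > 0]. *)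
Lemma singular_eh al be ga de b c d :
  c != 0 -> c - b - d != 0 ->
  cubic0 al be ga de 0 b c d = 0 ->
  dcubic0 al de ga be d c b = 0 -> dcubic0 al be ga de b c d = 0 ->
  let k := (al + ga) / (c * (c ^+ 2 + (b - d) ^+ 2) ^+ 2) in
  [/\ al = k * g0h b c d, be = k * g1h b c d,
      ga = k * g2h b c d & de = k * g3h b c d].
Proof.
move=> c0 m0 F0 Db Dd k.
pose Dc := (3 * c ^+ 2 - b * d) * al + (b ^+ 2 + 2 * c * d - b * d) * be
  + (- (b * d)) * ga + (2 * c * b + d ^+ 2 - b * d) * de.
have Dc0 : Dc = 0.
  apply: (mulfI c0); rewrite mulr0.
  have -> : c * Dc = 3 * cubic0 al be ga de 0 b c d
     - b * dcubic0 al de ga be d c b - d * dcubic0 al be ga de b c d.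
    by rewrite /Dc /cubic0 /cubic /dcubic0; ring.
  by rewrite F0 Db Dd !mulr0 !subr0.
have Db0 : (3 * b ^+ 2 - c * d) * al + (2 * b * c - c * d) * be
   + (2 * b * d + d ^+ 2 - c * d) * ga + (c ^+ 2 - c * d) * de = 0.
  by rewrite -Db /dcubic0; ring.
have Dd0 : (3 * d ^+ 2 - b * c) * al + (c ^+ 2 - b * c) * be
   + (b ^+ 2 + 2 * b * d - b * c) * ga + (2 * c * d - b * c) * de = 0.
  by rewrite -Dd /dcubic0; ring.
have [] := kernel_minors Db0 Dc0 Dd0.
set M2 := det3 _ _ _ _ _ _ _ _ _; set M0 := det3 _ _ _ _ _ _ _ _ _.
set M1 := - det3 _ _ _ _ _ _ _ _ _; set M3 := - det3 _ _ _ _ _ _ _ _ _.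
have -> : M0 = 3 * (c - b - d) * g0h b c d by rewrite /M0 /det3 /g0h; ring.
have -> : M1 = 3 * (c - b - d) * g1h b c d by rewrite /M1 /det3 /g1h; ring.
have -> : M2 = 3 * (c - b - d) * g2h b c d by rewrite /M2 /det3 /g2h; ring.
have -> : M3 = 3 * (c - b - d) * g3h b c d by rewrite /M3 /det3 /g3h /g1h; ring.
have m3 : 3 * (c - b - d) != 0 by rewrite mulf_neq0 // pnatr_eq0.
have cancel x y z t :
    x * (3 * (c - b - d) * y) = z * (3 * (c - b - d) * t) -> x * y = z * t.
  by rewrite !(mulrCA _ (3 * _)) => /(mulfI m3).
move=> /cancel e02 /cancel e10 /cancel e12 /cancel e30 /cancel e32.
have gE : g0h b c d + g2h b c d = c * (c ^+ 2 + (b - d) ^+ 2) ^+ 2.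
  by rewrite /g0h /g2h; ring.
have g_neq0 : c * (c ^+ 2 + (b - d) ^+ 2) ^+ 2 != 0.
  rewrite mulf_neq0 // expf_neq0 // gt_eqF //.
  by apply: ltr_wpDr; rewrite ?sqr_ge0 // exprn_even_gt0.
have kE x y : x * g0h b c d = al * y -> x * g2h b c d = ga * y -> x = k * y.
  move=> x0 x2; rewrite /k mulrAC; apply: (mulIf g_neq0); rewrite divfK //.
  by rewrite -gE mulrDr x0 x2 mulrDl.
by split; apply: kE; rewrite // -?e02.
Qed.

End SingularZero.

(** * Compactness of the triangle *)

Section Cover.
Variable R : realType.

(** Compactness of the unit interval, for an ideal [U] of sets: let [s] be the
supremum of the [x] with [[0, x]] in [U]; a neighbourhood of [s] is in [U], so
[s] is attained and is [1]. *)
Lemma interval_cover (U : (R -> Prop) -> Prop) :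
  (forall A B : R -> Prop, (forall x, A x -> B x) -> U B -> U A) ->
  (forall A B : R -> Prop, U A -> U B -> U (fun x => A x \/ B x)) ->
  (forall x, 0 <= x <= 1 -> exists2 e : R, 0 < e & U (fun y => `|y - x| <= e)) ->
  U (fun x => 0 <= x <= 1).
Proof.
move=> sub union loc.
pose S : R -> Prop := fun x => 0 <= x <= 1 /\ U (fun y => 0 <= y <= x).
have S0 : S 0.
  split; first by rewrite lexx ler01.
  have [|e e0] := loc 0; first by rewrite lexx ler01.
  by apply: sub => y; rewrite -eq_le => /eqP <-; rewrite subrr normr0 ltW.
have supS : has_sup S by split; [exists 0 | exists 1 => x [/andP[]]].
pose s := sup S.
have s0 : 0 <= s by apply: sup_upper_bound.
have s1 : s <= 1 by apply: ge_sup; [exists 0 | move=> x [/andP[]]].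
have [|e e0 Ue] := loc s; first by rewrite s0.
have [x [/andP[x0 x1] Ux] xs] := sup_adherent e0 supS; rewrite -/s in xs.
pose t := Num.min (s + e) 1.
have t1 : t <= 1 by rewrite ge_min lexx orbT.
have te : t <= s + e by rewrite ge_min lexx.
have St : S t.
  split; first by rewrite t1 le_min ler01 andbT; lra.
  apply: sub (union _ _ Ux Ue) => y /andP[y0 yt].
  have [yx|xy] := leP y x; [left | right; rewrite ler_norml];
    apply/andP; split; lra.
have ts : t <= s by apply: sup_upper_bound.
have t_eq1 : t = 1.
  by move: ts; rewrite /t; case: (leP (s + e) 1) => // _ h; exfalso; lra.
by rewrite -t_eq1; case: St.
Qed.

(** Two applications of [interval_cover]: the inner one, at a fixed abscissa,
yields a vertical strip in [U]. *)
Lemma square_cover (U : (R -> R -> Prop) -> Prop) :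
  (forall A B : R -> R -> Prop, (forall x y, A x y -> B x y) -> U B -> U A) ->
  (forall A B : R -> R -> Prop, U A -> U B -> U (fun x y => A x y \/ B x y)) ->
  (forall x y, 0 <= x <= 1 -> 0 <= y <= 1 -> exists2 e : R, 0 < e &
     U (fun x' y' => `|x' - x| <= e /\ `|y' - y| <= e)) ->
  U (fun x y => 0 <= x <= 1 /\ 0 <= y <= 1).
Proof.
move=> sub union loc.
apply: (@interval_cover (fun A => U (fun x y => A x /\ 0 <= y <= 1))).
- by move=> A B AB; apply: sub => x y [/AB].
- by move=> A B UA UB; apply: sub (union _ _ UA UB) => x y [[]]; [left | right].
move=> x x01.
apply: (@interval_cover
  (fun B => exists2 e : R, 0 < e & U (fun x' y => `|x' - x| <= e /\ B y))).
- by move=> A B AB [e e0 UB]; exists e => //; apply: sub UB => x' y [? /AB].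
- move=> A B [e e0 UA] [e' e'0 UB]; exists (Num.min e e').
    by rewrite lt_min e0.
  apply: sub (union _ _ UA UB) => x' y; rewrite le_min => -[/andP[? ?] []];
    by [left | right].
move=> y y01; have [e e0 Ue] := loc x y x01 y01; exists e => //; by exists e.
Qed.

End Cover.

Section Lipschitz.
Variable R : realFieldType.
Implicit Types (h k : R -> R -> R) (al be ga de : R).

(** One constant bounds both the values and the slopes, which makes the property
stable under products. *)
Definition lipschitz (h : R -> R -> R) : Prop :=
  exists2 L : R, 0 < L &
  forall x y x' y' : R,
    0 <= x <= 1 -> 0 <= y <= 1 -> 0 <= x' <= 1 -> 0 <= y' <= 1 ->
  `|h x y| <= L /\ `|h x y - h x' y'| <= L * (`|x - x'| + `|y - y'|).

Lemma lipschitz_cst (t : R) : lipschitz (fun=> fun=> t).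
Proof.
exists (`|t| + 1) => [|x y x' y' _ _ _ _]; first by rewrite ltr_wpDl.
by rewrite lerDl ler01 subrr normr0 mulr_ge0 ?addr_ge0.
Qed.

Lemma lipschitz_fst : lipschitz (fun x _ => x).
Proof.
exists 1 => // x y x' y' /andP[x0 x1] _ _ _; rewrite ger0_norm // x1.
by rewrite mul1r lerDl.
Qed.

Lemma lipschitz_snd : lipschitz (fun _ y => y).
Proof.
exists 1 => // x y x' y' _ /andP[y0 y1] _ _; rewrite ger0_norm // y1.
by rewrite mul1r lerDr.
Qed.

Lemma lipschitzD h k :
  lipschitz h -> lipschitz k -> lipschitz (fun x y => h x y + k x y).
Proof.
move=> [L L0 hL] [M M0 kM]; exists (L + M) => [|x y x' y' x01 y01 x01' y01'].
  exact: addr_gt0.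
have [h1 h2] := hL _ _ _ _ x01 y01 x01' y01'.
have [k1 k2] := kM _ _ _ _ x01 y01 x01' y01'.
split; first exact: le_trans (ler_normD _ _) (lerD h1 k1).
by rewrite opprD addrACA mulrDl; apply: le_trans (ler_normD _ _) (lerD h2 k2).
Qed.

Lemma lipschitzM h k :
  lipschitz h -> lipschitz k -> lipschitz (fun x y => h x y * k x y).
Proof.
move=> [L L0 hL] [M M0 kM]; exists (L * M + L * M).
  by rewrite addr_gt0 ?mulr_gt0.
move=> x y x' y' x01 y01 x01' y01'.
have [h1 h2] := hL _ _ _ _ x01 y01 x01' y01'.
have [k1 _] := kM _ _ _ _ x01' y01' x01 y01.
have [k3 k2] := kM _ _ _ _ x01 y01 x01' y01'.
split.
  rewrite normrM; apply: le_trans (ler_pM _ _ h1 k3) _ => //.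
  by rewrite lerDl mulr_ge0 ?ltW.
set D := `|x - x'| + _ in h2 k2 *.
have -> : h x y * k x y - h x' y' * k x' y' =
  h x y * (k x y - k x' y') + (h x y - h x' y') * k x' y' by ring.
apply: le_trans (ler_normD _ _) _; rewrite !normrM.
have -> : (L * M + L * M) * D = L * (M * D) + L * D * M by ring.
by apply: lerD; apply: ler_pM.
Qed.

Lemma lipschitz_pos h x0 y0 :
  lipschitz h -> 0 <= x0 <= 1 -> 0 <= y0 <= 1 -> 0 < h x0 y0 ->
  exists2 e : R, 0 < e & exists2 m : R, 0 < m &
    forall x y, 0 <= x <= 1 -> 0 <= y <= 1 -> `|x - x0| <= e -> `|y - y0| <= e ->
      m <= h x y.
Proof.
move=> [L L0 hL] x001 y001 h0.
exists (h x0 y0 / (4 * L)); first by rewrite divr_gt0 ?mulr_gt0.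
exists (h x0 y0 / 2); first by rewrite divr_gt0.
move=> x y x01 y01 xx0 yy0.
have [_] := hL _ _ _ _ x001 y001 x01 y01.
rewrite (distrC x0) (distrC y0) => hxy.
have : L * (`|x - x0| + `|y - y0|) <= h x0 y0 / 2.
  have -> : h x0 y0 / 2 = L * (h x0 y0 / (4 * L) + h x0 y0 / (4 * L)).
    by field; rewrite gt_eqF.
  by rewrite ler_pM2l // lerD.
have := ler_norm (h x0 y0 - h x y); lra.
Qed.

Ltac lipschitz_tac := rewrite ?exprS ?expr0;
  do ! [exact: lipschitz_cst | exact: lipschitz_fst | exact: lipschitz_snd
       | apply: lipschitzD | apply: lipschitzM].

(** Barycentric coordinates on the triangle are [x], [y] and [third x y]; the
minus sign is a factor [-1] so that [lipschitzD] and [lipschitzM] apply. *)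
Definition third (x y : R) : R := 1 + (-1) * (x + y).

Definition in_triangle (x y : R) := [&& 0 <= x, 0 <= y & 0 <= third x y].

Lemma in_triangle_le1 x y : in_triangle x y ->
  [/\ 0 <= x <= 1, 0 <= y <= 1 & 0 <= third x y <= 1].
Proof.
rewrite /in_triangle /third => /and3P[x0 y0 z0].
by split; apply/andP; split; lra.
Qed.

Lemma lipschitz_third : lipschitz third.
Proof. by rewrite /third; lipschitz_tac. Qed.

Lemma lipschitz_cubic0 al be ga de :
  lipschitz (fun b c => cubic0 al be ga de 0 b c (third b c)).
Proof. by rewrite /cubic0 /cubic /third; lipschitz_tac. Qed.

Definition side_quotient al be ga de b c d : R :=
  al * (d * d) + be * (c * c) + ga * (b * b + d * b) + de * (d * c)
  + (- (al + be + ga + de)) * (b * c).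

Lemma cubic0_side_quotient al be ga de b c d :
  cubic0 al be ga de 0 b c d =
  cubic0 al be ga de 0 b c 0 + d * side_quotient al be ga de b c d.
Proof. by rewrite /cubic0 /cubic /side_quotient; ring. Qed.

Lemma lipschitz_side_quotient al be ga de :
  lipschitz (fun b c => side_quotient al be ga de b c (third b c)).
Proof. by rewrite /side_quotient /third; lipschitz_tac. Qed.

Lemma lipschitz_side_quotient_flip al be ga de :
  lipschitz (fun b c => side_quotient al be ga de (third b c) c b).
Proof. by rewrite /side_quotient /third; lipschitz_tac. Qed.

End Lipschitz.

(** * Existence of a singular zero *)

Section Bound.
Variable R : realType.
Implicit Types (b c d al be ga de : R).

(** Being bounded by a multiple of [F] is a local property of [S]. The local
bound is asked in the form it has near a simple zero: [S] is at most [k], and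
[F] at least [k] times a function which is positive at the point. *)
Lemma triangle_bound (S F : R -> R -> R) :
  (forall x y, in_triangle x y -> 0 <= S x y) ->
  (forall x y, in_triangle x y -> exists h k : R -> R -> R,
     [/\ lipschitz h, 0 < h x y & forall x' y', in_triangle x' y' ->
       S x' y' <= k x' y' /\ k x' y' * h x' y' <= F x' y']) ->
  exists2 e : R, 0 < e & forall x y, in_triangle x y -> e * S x y <= F x y.
Proof.
move=> S_ge0 loc.
pose U (A : R -> R -> Prop) := exists2 e : R, 0 < e &
  forall x y, A x y -> in_triangle x y -> e * S x y <= F x y.
suff [e e0 Ue] : U (fun x y => 0 <= x <= 1 /\ 0 <= y <= 1).
  by exists e => // x y xy; apply: Ue => //; have [? ? _] := in_triangle_le1 xy.
apply: square_cover.
- by move=> A B AB [e e0 UB]; exists e => // x y /AB; apply: UB.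
- move=> A B [e e0 UA] [e' e'0 UB]; exists (Num.min e e').
    by rewrite lt_min e0.
  move=> x y AB xy; case: AB => [/UA|/UB] /(_ xy); apply: le_trans;
    by apply: ler_wpM2r; rewrite ?S_ge0 // ge_min lexx ?orbT.
move=> x y x01 y01; have [xy|/negP xyN] := boolP (in_triangle x y); last first.
  have [/andP[x0 _] /andP[y0 _]] := (x01, y01).
  have z0 : third x y < 0.
    by rewrite ltNge; apply/negP => z0; apply: xyN; apply/and3P.
  have lip : lipschitz (fun x y : R => (-1) * third x y).
    by apply: lipschitzM; [exact: lipschitz_cst | exact: lipschitz_third].
  have [|e e0 [m m0 zm]] := lipschitz_pos lip x01 y01.
    by rewrite mulN1r oppr_gt0.
  (* The neighbourhood misses the triangle, so any factor will do. *)
  exists e => //; exists 1 => // x' y' [xx' yy'] xy'.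
  have [x'01 y'01 /andP[z'0 _]] := in_triangle_le1 xy'.
  by have := zm _ _ x'01 y'01 xx' yy'; lra.
have [h [k [lip h0 hk]]] := loc x y xy.
have [e e0 [m m0 hm]] := lipschitz_pos lip x01 y01 h0.
exists e => //; exists m => // x' y' [xx' yy'] xy'.
have [x'01 y'01 _] := in_triangle_le1 xy'; have [Sk khF] := hk _ _ xy'.
apply: le_trans khF; apply: (@le_trans _ _ (m * k x' y')).
  by rewrite ler_pM2l.
rewrite mulrC; apply: ler_wpM2l; last exact: hm.
exact: le_trans (S_ge0 _ _ xy') Sk.
Qed.

(** An interior zero is a minimum; on the edge [d = 0] the derivative is both
nonnegative, by minimality, and nonpositive, being [side_quotient]. *)
Lemma cubic0_derivative_eq0 al be ga de b c d : side_ge0 al be ga de ->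
  0 <= b -> 0 <= c -> 0 <= d -> cubic0 al be ga de 0 b c d = 0 ->
  side_quotient al be ga de b c d <= 0 -> dcubic0 al be ga de b c d = 0.
Proof.
move=> f_ge0 b0 c0 d0 F0 q_le0.
have taylor t : - d <= t ->
    0 <= t * (dcubic0 al be ga de b c d
              + t * ((3 * al * d + ga * b + de * c) + t * al)).
  move=> td; have := f_ge0 b c (d + t) b0 c0.
  have -> : cubic0 al be ga de 0 b c (d + t) = cubic0 al be ga de 0 b c d
      + t * (dcubic0 al be ga de b c d
             + t * ((3 * al * d + ga * b + de * c) + t * al)).
    by rewrite /cubic0 /cubic /dcubic0; ring.
  by rewrite F0 add0r; apply; lra.
move: d0; rewrite le_eqVlt => /orP[/eqP d0|d0].
  apply/eqP; rewrite eq_le; apply/andP; split.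
    apply: le_trans q_le0; rewrite le_eqVlt; apply/orP; left; apply/eqP.
    by rewrite -d0 /dcubic0 /side_quotient; ring.
  by apply: (slope_ge0 ltr01) => t /andP[t0 _]; apply: taylor; rewrite -d0 oppr0.
by apply: (slope_eq0 d0) => t /andP[td _]; apply: taylor.
Qed.

(** If [b d (b + c + d)] is not bounded by a multiple of the form, then local
boundedness fails at some point. It fails neither where the form is positive,
nor where one of the two side quotients is: there the form is at least a
positive multiple of [d], respectively [b]. Elsewhere
[cubic0_derivative_eq0] applies to [d] and, after a reflection, to [b]. *)
Lemma singular_zero_exists al be ga de : side_ge0 al be ga de -> 0 < al + ga ->
  (forall e : R, 0 < e -> ~ forall b c d, 0 <= b -> 0 <= c -> 0 <= d ->
     e * (b * d * (b + c + d)) <= cubic0 al be ga de 0 b c d) ->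
  exists b c d : R, [/\ 0 <= b, 0 < c & 0 <= d] /\
   [/\ cubic0 al be ga de 0 b c d = 0, dcubic0 al de ga be d c b = 0 &
       dcubic0 al be ga de b c d = 0].
Proof.
move=> f_ge0 B_gt0 not_bounded; apply: contrapT => no_singular.
have f_ge0' : side_ge0 al de ga be.
  by move=> b c d b0 c0 d0; rewrite -cubic0_flip f_ge0.
have [|x y xy|e e0 Ue] := @triangle_bound (fun x y => x * third x y)
    (fun x y => cubic0 al be ga de 0 x y (third x y)).
- by move=> x y /and3P[x0 _ z0]; apply: mulr_ge0.
- have [F0|F0] := ltP 0 (cubic0 al be ga de 0 x y (third x y)).
    exists (fun x y => cubic0 al be ga de 0 x y (third x y)), (fun=> fun=> 1).
    split=> // [|x' y' xy']; first exact: lipschitz_cubic0.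
    have [/andP[? ?] _ /andP[? ?]] := in_triangle_le1 xy'.
    by rewrite mul1r mulr_ile1.
  have [g1|g1] := ltP 0 (side_quotient al be ga de x y (third x y)).
    exists (fun x y => side_quotient al be ga de x y (third x y)), (@third R).
    split=> // [|x' y' xy']; first exact: lipschitz_side_quotient.
    have [/andP[? ?] /andP[? _] /andP[? _]] := in_triangle_le1 xy'.
    rewrite ler_piMl // cubic0_side_quotient; split=> //.
    by apply: ler_wpDl => //; apply: f_ge0.
  have [g2|g2] := ltP 0 (side_quotient al de ga be (third x y) y x).
    exists (fun x y => side_quotient al de ga be (third x y) y x), (fun x _ => x).
    split=> // [|x' y' xy']; first exact: lipschitz_side_quotient_flip.
    have [/andP[? _] /andP[? _] /andP[? ?]] := in_triangle_le1 xy'.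
    rewrite ler_piMr // cubic0_flip cubic0_side_quotient; split=> //.
    by apply: ler_wpDl => //; apply: f_ge0'.
  exfalso; case/and3P: xy => x0 y0 z0.
  have {}F0 : cubic0 al be ga de 0 x y (third x y) = 0.
    by apply/eqP; rewrite eq_le F0 f_ge0.
  move: y0; rewrite le_eqVlt => /orP[/eqP y0|y0]; last first.
    apply: no_singular; exists x, y, (third x y); split=> //; split=> //.
      apply: cubic0_derivative_eq0 => //; first exact: ltW.
      by rewrite -cubic0_flip.
    by apply: cubic0_derivative_eq0 => //; exact: ltW.
  (* On the edge [c = 0] the form is [al (b - d)^2 + (al + ga) b d], up to the
     factor [b + d]. So a zero is a vertex and forces [al = 0]; then one of
     the side quotients at that vertex is [ga], which is positive. *)
  have zE : third x y = 1 - x by rewrite /third -y0; ring.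
  move: z0 F0 g1 g2; rewrite zE -y0 => z0 F0 g1 g2.
  have al_ge0 : 0 <= al.
    have := f_ge0 1 0 0 ler01 (lexx 0) (lexx 0).
    by rewrite /cubic0 /cubic; congr (0 <= _); ring.
  have {}F0 : al * (x - (1 - x)) ^+ 2 + (al + ga) * (x * (1 - x)) = 0.
    by rewrite -F0 /cubic0 /cubic; ring.
  have sq_ge0 := mulr_ge0 al_ge0 (sqr_ge0 (x - (1 - x))).
  have prod_ge0 := mulr_ge0 (ltW B_gt0) (mulr_ge0 x0 z0).
  have sq0 : al * (x - (1 - x)) ^+ 2 = 0 by lra.
  have /eqP : (al + ga) * (x * (1 - x)) = 0 by lra.
  rewrite !mulf_eq0 (gt_eqF B_gt0) /= subr_eq0 => /orP[|] /eqP xE.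
    by move: sq0 g2; rewrite xE /side_quotient; lra.
  by move: sq0 g1; rewrite -xE /side_quotient; lra.
apply: (not_bounded _ e0) => b c d b0 c0 d0.
have [s_le0|s_gt0] := leP (b + c + d) 0.
  have [-> -> ->] : [/\ b = 0, c = 0 & d = 0] by split; lra.
  by rewrite /cubic0 /cubic !(expr0n, mul0r, mulr0, addr0).
set s := b + c + d in s_gt0 *; have s_neq0 : s != 0 by rewrite gt_eqF.
have dE : third (b / s) (c / s) = d / s by rewrite /third /s; field.
have := Ue (b / s) (c / s); rewrite /in_triangle dE.
rewrite !divr_ge0 ?(ltW s_gt0) // => /(_ isT).
rewrite -(ler_pM2l (exprn_gt0 3 s_gt0)) -cubic0_homog.
by rewrite !(mulrC s) !divfK //; congr (_ <= _); field.
Qed.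

End Bound.

(** * Extremal forms *)

Section Extremal.
Variable R : realType.
Implicit Types (f : {mpoly R[4]}) (a b c d al be ga de ep k t : R).

Lemma cyclic_form_eval al be ga de ep a b c d :
  (cyclic_form al be ga de ep).@[point4 a b c d] = cubic al be ga de ep a b c d.
Proof.
rewrite /cyclic_form /S3 /S210 /S201 /S120 /S111 !sum_I4 !addI4.
by rewrite !(mevalD, mevalZ, mevalM, mevalXU, exprS, expr0, mulr1).
Qed.

Lemma cyclic_form_cyclic al be ga de ep : cyclic_cubic (cyclic_form al be ga de ep).
Proof.
split.
  rewrite /cyclic_form /S3 /S210 /S201 /S120 /S111.
  have hX (i : 'I_4) : ('X_i : {mpoly R[4]}) \is 1.-homog.
    by rewrite dhomogX; apply/eqP; exact: mdeg1.
  do ! [apply: rpredD]; apply: rpredZ; apply: rpred_sum => i _.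
  - exact: (@dhomogMn _ _ _ _ _ 3 (hX i)).
  - exact: (dhomogM (dhomogMn 2 (hX i)) (hX _)).
  - exact: (dhomogM (dhomogMn 2 (hX i)) (hX _)).
  - exact: (dhomogM (dhomogMn 2 (hX i)) (hX _)).
  - exact: (dhomogM (dhomogM (hX i) (hX _)) (hX _)).
have fixed (F : 'I_4 -> {mpoly R[4]}) :
    (forall i, cycle_vars (F i) = F (i + 1)) ->
    cycle_vars (\sum_i F i) = \sum_i F i.
  by move=> FE; rewrite !sum_I4 !cycle_varsD !FE !addI4 [LHS]addrC !addrA.
rewrite -/(cycle_vars _) /cyclic_form !cycle_varsD !cycle_varsZ.
congr (_ *: _ + _ *: _ + _ *: _ + _ *: _ + _ *: _); apply: fixed => i;
  by rewrite ?(exprS, expr0, mulr1) !cycle_varsM !cycle_varsX ?(addrAC _ 1).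
Qed.

Definition form0 al be ga de : {mpoly R[4]} :=
  cyclic_form al be ga de (- (al + be + ga + de)).

Lemma form0_eval al be ga de a b c d :
  (form0 al be ga de).@[point4 a b c d] = cubic0 al be ga de a b c d.
Proof. exact: cyclic_form_eval. Qed.

Lemma form0E al be ga de :
  al *: s0 R + be *: s1 R + ga *: s2 R + de *: s3 R = form0 al be ga de.
Proof.
rewrite /form0 /cyclic_form scaleNr !scalerDl !opprD /s0 /s1 /s2 /s3 !scalerBr.
by rewrite (AC (2*2*2*2) (1*3*5*7*(2*4*6*8)))%AC.
Qed.

Lemma form0Z k al be ga de :
  k *: form0 al be ga de = form0 (k * al) (k * be) (k * ga) (k * de).
Proof. by rewrite -!form0E !scalerDr !scalerA. Qed.

Lemma form0D al be ga de al' be' ga' de' :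
  form0 al be ga de + form0 al' be' ga' de' =
  form0 (al + al') (be + be') (ga + ga') (de + de').
Proof.
by rewrite -!form0E !scalerDl (AC (4*4) (1*5*(2*6)*(3*7)*(4*8)))%AC.
Qed.

Lemma form0_inj al be ga de al' be' ga' de' :
  form0 al be ga de = form0 al' be' ga' de' ->
  [/\ al = al', be = be', ga = ga' & de = de'].
Proof.
move=> fE; have ev a b c d :
    cubic0 al be ga de a b c d = cubic0 al' be' ga' de' a b c d.
  by rewrite -!form0_eval fE.
have := (ev 1 0 0 0, ev 1 0 1 0, ev 1 1 0 0, ev 2 1 0 0).
by rewrite /cubic0 /cubic => -[[[e1 e2] e3] e4]; split; lra.
Qed.

Lemma Pc0plus_form0 al be ga de :
  side_ge0 al be ga de -> Pc0plus (form0 al be ga de).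
Proof.
move=> f_ge0; split; last first.
  by move=> a b c d a0 b0 c0 d0; rewrite form0_eval; apply: cubic0_ge0.
split; first exact: cyclic_form_cyclic.
by rewrite form0_eval /cubic0 /cubic; ring.
Qed.

Lemma Pc0plusE f : Pc0plus f -> exists al be ga de,
  f = form0 al be ga de /\ side_ge0 al be ga de.
Proof.
move=> [[cyc_f f1] f_ge0].
have [al [be [ga [de [ep fE]]]]] := cyclic_cubicE cyc_f.
exists al, be, ga, de; have epE : ep = - (al + be + ga + de).
  by move: f1; rewrite fE cyclic_form_eval /cubic; lra.
have {}fE : f = form0 al be ga de by rewrite fE epE.
split=> // b c d b0 c0 d0.
by have := f_ge0 0 b c d (lexx 0) b0 c0 d0; rewrite fE form0_eval.
Qed.

Lemma extremal_summand al be ga de al' be' ga' de' :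
  extremal (@Pc0plus R) (form0 al be ga de) ->
  side_ge0 al' be' ga' de' ->
  side_ge0 (al - al') (be - be') (ga - ga') (de - de') ->
  exists k, [/\ al' = k * al, be' = k * be, ga' = k * ga & de' = k * de].
Proof.
move=> [_ _ extr] /Pc0plus_form0 Pg /Pc0plus_form0 Ph.
have [|[k gE] _] := extr _ _ Pg Ph.
  by rewrite form0D; congr form0; ring.
by exists k; apply: form0_inj; rewrite -form0Z.
Qed.

Lemma extremal_unscale f k : 0 < k ->
  extremal (@Pc0plus R) (k *: f) -> extremal (@Pc0plus R) f.
Proof.
move=> k0 [Pkf kf_neq0 extr]; have k_neq0 : k != 0 by rewrite gt_eqF.
have PZ (l : R) (g : {mpoly R[4]}) : 0 < l -> Pc0plus g -> Pc0plus (l *: g).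
  move=> l0 Pg; have [al [be [ga [de [-> g_ge0]]]]] := Pc0plusE Pg; rewrite form0Z.
  apply: Pc0plus_form0 => b c d b0 c0 d0.
  have -> : cubic0 (l * al) (l * be) (l * ga) (l * de) 0 b c d
      = l * cubic0 al be ga de 0 b c d by rewrite /cubic0 /cubic; ring.
  by rewrite mulr_ge0 ?g_ge0 // ltW.
split=> [||g h Pg Ph fE].
- by rewrite -[f](scalerK k_neq0); apply: PZ; rewrite ?invr_gt0.
- by apply: contra_neq kf_neq0 => ->; rewrite scaler0.
have [|[x gE] [y hE]] := extr _ _ (PZ _ _ k0 Pg) (PZ _ _ k0 Ph).
  by rewrite fE scalerDr.
by split; [exists x | exists y]; apply: (scalerI k_neq0);
  rewrite ?gE ?hE !scalerA mulrC.
Qed.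

Lemma eP2_SomeE t : eP2 (Some t) = form0 1 (t * (t - 2)) (-1) (t * (t + 2)).
Proof. by rewrite -form0E scale1r scaleN1r. Qed.

Lemma eP2_NoneE : eP2 None = form0 0 1 0 1.
Proof. by rewrite -form0E !scale0r !scale1r add0r addr0. Qed.

(** Subtracting the largest possible multiple of [y^2] from the quadratic form
leaves the square [al (x - t y)^2], and the subtracted term is itself in the
cone. *)
Lemma extremal_B0 al be de :
  extremal (@Pc0plus R) (form0 al be (- al) de) -> side_ge0 al be (- al) de ->
  exists2 k : R, 0 < k & exists t : option R, form0 al be (- al) de = k *: eP2 t.
Proof.
move=> extr /B0_cone [].
set eta := (be + de) / 2; set ka := (be - de) / 4 => al_ge0 eta_ge0 rank1.
have beE : be = eta + 2 * ka by rewrite /eta /ka; field.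
have deE : de = eta - 2 * ka by rewrite /eta /ka; field.
move: al_ge0; rewrite le_eqVlt => /orP[/eqP al0|al_gt0].
  have ka0 : ka = 0.
    move: rank1; rewrite -al0 mul0r => ka_le0.
    by apply/eqP; rewrite -sqrf_eq0 eq_le ka_le0 sqr_ge0.
  exists eta; last first.
    exists None; rewrite eP2_NoneE form0Z -al0 beE deE ka0.
    by congr form0; ring.
  rewrite lt_neqAle eta_ge0 andbT; apply/eqP => eta0.
  have [_ /eqP f_neq0 _] := extr; case: f_neq0; rewrite -al0 beE deE ka0 -eta0.
  by rewrite -form0E !(mulr0, addr0, subr0, oppr0, scale0r).
pose t := - ka / al; pose eta' := eta - al * t ^+ 2.
have tE : al * t = - ka by rewrite /t mulrC divfK ?gt_eqF.
have kaE : ka = - (al * t) by rewrite tE opprK.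
have eta'_ge0 : 0 <= eta'.
  rewrite -(pmulr_rge0 _ al_gt0) /eta'.
  have -> : al * (eta - al * t ^+ 2) = al * eta - (al * t) ^+ 2 by ring.
  by rewrite tE sqrrN subr_ge0.
have [] := extremal_summand extr (al' := 0) (be' := eta') (ga' := 0) (de' := eta').
- move=> b c d b0 c0 d0.
  have -> : cubic0 0 eta' 0 eta' 0 b c d = eta' * cubic0 0 1 0 1 0 b c d.
    by rewrite /cubic0 /cubic; ring.
  by rewrite mulr_ge0 // eP2_None_side_ge0.
- move=> b c d b0 c0 d0.
  have -> : cubic0 (al - 0) (be - eta') (- al - 0) (de - eta') 0 b c d
      = al * cubic0 1 (t * (t - 2)) (-1) (t * (t + 2)) 0 b c d.
    have -> : be - eta' = al * (t * (t - 2)).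
      by rewrite beE /eta' kaE; ring.
    have -> : de - eta' = al * (t * (t + 2)).
      by rewrite deE /eta' kaE; ring.
    by rewrite /cubic0 /cubic; ring.
  by rewrite mulr_ge0 ?eP2_side_ge0 // ltW.
move=> k [kal eta'E _ _].
have k0 : k = 0.
  by apply/eqP; move/esym/eqP: kal; rewrite mulf_eq0 (gt_eqF al_gt0) orbF.
rewrite k0 mul0r in eta'E.
have etaE : eta = al * t ^+ 2 by move: eta'E; rewrite /eta'; lra.
exists al => //; exists (Some t); rewrite eP2_SomeE form0Z.
by congr form0; rewrite ?beE ?deE ?etaE ?kaE; ring.
Qed.

(** If the bound held, [(f + e s2) / 2] and [(f - e s2) / 2] would be in the cone
and would be multiples of [f]. Comparing the values of [2 al + be + de] on
[f] and [f + e s2], the factor is [1 / 2] and [e = 0]. *)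
Lemma extremal_unbounded al be ga de :
  extremal (@Pc0plus R) (form0 al be ga de) -> 0 < 2 * al + be + de ->
  forall e : R, 0 < e -> ~ forall b c d, 0 <= b -> 0 <= c -> 0 <= d ->
     e * (b * d * (b + c + d)) <= cubic0 al be ga de 0 b c d.
Proof.
move=> extr A_gt0 e e0 bounded.
have s2_le b c d : 0 <= b -> 0 <= c -> 0 <= d ->
    `|e * (b * d * (b + d - c))| <= cubic0 al be ga de 0 b c d.
  move=> b0 c0 d0; apply: le_trans (bounded b c d b0 c0 d0).
  rewrite normrM (gtr0_norm e0) ler_pM2l // normrM.
  rewrite (ger0_norm (mulr_ge0 b0 d0)); apply: ler_wpM2l; first exact: mulr_ge0.
  by rewrite ler_norml; lra.
have [||k [alE beE gaE deE]] := extremal_summand extr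
  (al' := al / 2) (be' := be / 2) (ga' := (ga + e) / 2) (de' := de / 2).
- move=> b c d b0 c0 d0.
  have -> : cubic0 (al / 2) (be / 2) ((ga + e) / 2) (de / 2) 0 b c d =
     (cubic0 al be ga de 0 b c d + e * (b * d * (b + d - c))) / 2.
    by rewrite /cubic0 /cubic; field.
  by have := s2_le b c d b0 c0 d0; rewrite ler_norml; lra.
- move=> b c d b0 c0 d0.
  have -> : cubic0 (al - al / 2) (be - be / 2) (ga - (ga + e) / 2) (de - de / 2)
      0 b c d = (cubic0 al be ga de 0 b c d - e * (b * d * (b + d - c))) / 2.
    by rewrite /cubic0 /cubic; field.
  by have := s2_le b c d b0 c0 d0; rewrite ler_norml; lra.
have : (k - 1 / 2) * (2 * al + be + de) = 0.
  have -> : (k - 1 / 2) * (2 * al + be + de)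
    = 2 * (k * al) + k * be + k * de - (2 * al + be + de) / 2 by field.
  by rewrite -alE -beE -deE; field.
move=> /eqP; rewrite mulf_eq0 (gt_eqF A_gt0) orbF subr_eq0 => /eqP kE.
by move: gaE; rewrite kE; lra.
Qed.

(** If [2 al + be + de] vanishes, the point is [(1 : 2 : 1)], one of the zeros of
the form on the line [c = b + d]; otherwise it is the singular zero. *)
Lemma extremal_Bpos al be ga de :
  extremal (@Pc0plus R) (form0 al be ga de) -> side_ge0 al be ga de ->
  0 < al + ga ->
  exists2 k : R, 0 < k & exists u v w : R,
    [/\ P2plus u v w, ~ is_point_101 u v w & form0 al be ga de = k *: eh u v w].
Proof.
move=> extr f_ge0 B_gt0.
have not_101 u v w : 0 < v -> ~ is_point_101 u v w.
  by move=> v0 [v_eq0 _]; move: v0; rewrite v_eq0 ltxx.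
have P2 u v w : 0 <= u -> 0 < v -> 0 <= w -> P2plus u v w.
  move=> u0 v0 w0; split=> //; first exact: ltW.
  by apply/eqP => -[_ v_eq0 _]; move: v0; rewrite v_eq0 ltxx.
have : 0 <= 2 * al + be + de.
  have := f_ge0 1 2 1 ler01 (ler0n _ _) ler01.
  have -> : cubic0 al be ga de 0 1 2 1 = 4 * (2 * al + be + de).
    by rewrite /cubic0 /cubic; ring.
  by rewrite pmulr_rge0.
rewrite le_eqVlt => /orP[/eqP/esym A0|A_gt0].
  have [beE gaE deE] := A0_ray f_ge0 A0.
  exists (al / 8); first by lra.
  exists 1, 2, 1; split; [exact: P2 | exact: not_101 |].
  rewrite /eh form0E form0Z beE gaE deE /g3h /g0h /g1h /g2h.
  by congr form0; field.
have [b [c [d [[b0 c0 d0] [F0 Db0 Dd0]]]]] :=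
  singular_zero_exists f_ge0 B_gt0 (extremal_unbounded extr A_gt0).
have m_neq0 : c - b - d != 0.
  (* On the line [c = b + d] only the coefficient [2 al + be + de] of the form
     survives. *)
  apply/eqP => m0; have cE : c = b + d by lra.
  have : 0 < (2 * al + be + de) * (c * (c ^+ 2 + (b - d) ^+ 2)).
    apply: mulr_gt0 => //; apply: mulr_gt0 => //.
    by apply: ltr_wpDr; rewrite ?sqr_ge0 ?exprn_gt0.
  have -> : (2 * al + be + de) * (c * (c ^+ 2 + (b - d) ^+ 2)) =
      2 * cubic0 al be ga de 0 b c d.
    by rewrite cE /cubic0 /cubic; ring.
  by rewrite F0 mulr0 ltxx.
have [] := singular_eh (lt0r_neq0 c0) m_neq0 F0 Db0 Dd0.
set k := _ / _ => alE beE gaE deE.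
exists k.
  rewrite divr_gt0 // mulr_gt0 // exprn_gt0 //.
  by apply: ltr_wpDr; rewrite ?sqr_ge0 ?exprn_gt0.
exists b, c, d; split; [exact: P2 | exact: not_101 |].
by rewrite /eh form0E form0Z alE beE gaE deE.
Qed.

End Extremal.

Theorem theorem1p10 (R : realType) :
  (forall f : {mpoly R[4]}, extremal (@Pc0plus R) f ->
     exists2 k : R, 0 < k &
       (exists u v w : R, Deh u v w /\ f = k *: eh u v w)
       \/ (exists t : option R, f = k *: eP2 t))
  /\
  (forall f : {mpoly R[4]}, cyclic_cubic f ->
     0 <= f.@[point4 1 1 1 1] ->
     (forall s t : R, 0 <= s -> 0 <= t -> 0 <= f.@[point4 0 s t 1]) ->
     forall a b c d : R,
       0 <= a -> 0 <= b -> 0 <= c -> 0 <= d -> 0 <= f.@[point4 a b c d]).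
Proof.
split=> [f extr_f | f cyc_f one_ge0 side].
  have [Pf _ _] := extr_f.
  have [al [be [ga [de [fE f_ge0]]]]] := Pc0plusE Pf; rewrite {Pf}fE in extr_f *.
  have : 0 <= al + ga.
    have := f_ge0 1 0 1 ler01 (lexx 0) ler01.
    have -> : cubic0 al be ga de 0 1 0 1 = 2 * (al + ga).
      by rewrite /cubic0 /cubic; ring.
    by rewrite pmulr_rge0.
  rewrite le_eqVlt => /orP[/eqP B0|B_gt0].
    have gaE : ga = - al by lra.
    rewrite gaE in extr_f f_ge0 *.
    by have [k k0 fE] := extremal_B0 extr_f f_ge0; exists k => //; right.
  have [k k0 [u [v [w [P2 not_101 fE]]]]] := extremal_Bpos extr_f f_ge0 B_gt0.
  exists k => //; left; exists u, v, w; split=> //; split=> //.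
  by apply: (extremal_unscale k0); rewrite -fE.
have [al [be [ga [de [ep fE]]]]] := cyclic_cubicE cyc_f.
rewrite {cyc_f}fE in one_ge0 side *.
move=> a b c d; rewrite cyclic_form_eval; move: a b c d; apply: cubic_ge0.
  by move: one_ge0; rewrite cyclic_form_eval /cubic; lra.
have pos b' c' d' : 0 <= b' -> 0 <= c' -> 0 < d' ->
    0 <= cubic al be ga de ep 0 b' c' d'.
  move=> b0 c0 d0; have := side (b' / d') (c' / d').
  rewrite cyclic_form_eval !divr_ge0 ?(ltW d0) // => /(_ isT isT).
  rewrite -(pmulr_rge0 _ (exprn_gt0 3 d0)); congr (0 <= _).
  by rewrite /cubic; field; rewrite gt_eqF.
(* For [d = 0], a rotation moves a positive variable to the last place. *)
move=> b c d b0 c0 d0; move: d0; rewrite le_eqVlt.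
case/orP => [/eqP <-|]; last exact: pos.
move: c0; rewrite le_eqVlt => /orP[/eqP <-|c0].
  move: b0; rewrite le_eqVlt => /orP[/eqP <-|b0].
    by rewrite /cubic !(expr0n, mul0r, mulr0, addr0).
  by rewrite 2!cubic_rot pos.
by rewrite cubic_rot pos // ltW.
Qed.
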